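(* Let $d,g\in\mathcal{F}_0$ and $f\in\mathcal{F}_1$. If $f$ is a Pólya frequency formal power series and the quasi-Riordan array $[d,tg]$ is totally positive, then the almost-Riordan array $(d\,|\,g,f)$ is also totally positive.
   Context: For $k\ge 0$, $\mathcal{F}_k$ denotes the set of formal power series $\sum_{n\ge k}a_nt^n$ with real coefficients and $a_k\neq 0$. All matrices are infinite, with rows and columns indexed by $0,1,2,\dots$; writing a matrix as a list $(u_0,u_1,u_2,\dots)$ of formal power series means that the $(n,k)$ entry is the coefficient of $t^n$ in $u_k$. The almost-Riordan array is $(d\,|\,g,f)=(d,tg,tgf,tgf^2,\dots)$. For $d\in\mathcal{F}_0$ and $h\in\mathcal{F}_1$ the quasi-Riordan array is $[d,h]=(d,h,th,t^2h,\dots)$; thus $[d,tg]=(d,tg,t^2g,t^3g,\dots)$. An infinite matrix is totally positive (TP) if its minors of all orders are nonnegative. A nonnegative sequence $(a_n)_{n\ge 0}$ is a Pólya frequency sequence if its Toeplitz matrix $[a_{i-j}]_{i,j\ge 0}$ (with $a_m=0$ for $m<0$) is totally positive; its generating function $\sum_{n\ge 0}a_nt^n$ is then called a Pólya frequency formal power series. *)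

(* Defs.v *)
From mathcomp Require Import all_boot all_order all_algebra.
From mathcomp Require Import reals.
Set Implicit Arguments.
Unset Strict Implicit.
Unset Printing Implicit Defensive.
Import Order.TTheory GRing.Theory Num.Theory.
Local Open Scope ring_scope.

(* A formal power series is identified with its sequence of coefficients:
   [a n] is the coefficient of t^n. *)
Definition fps (R : realType) := nat -> R.

Definition fps_one (R : realType) : fps R := fun n => (n == 0)%N%:R.

Definition fps_t (R : realType) : fps R := fun n => (n == 1)%N%:R.

Definition fps_mul (R : realType) (a b : fps R) : fps R :=
  fun n => \sum_(i < n.+1) a i * b (n - i)%N.

Definition fps_exp (R : realType) (a : fps R) (k : nat) : fps R :=
  iter k (fps_mul a) (fps_one R).

Definition fps_order (R : realType) (k : nat) (a : fps R) : Prop :=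
  (forall n, (n < k)%N -> a n = 0) /\ a k != 0.

Definition infmx (R : realType) := nat -> nat -> R.

Definition infmx_of_cols (R : realType) (u : nat -> fps R) : infmx R :=
  fun n k => u k n.

(* (d | g, f) = (d, t g, t g f, t g f^2, ...) *)
Definition almost_riordan (R : realType) (d g f : fps R) : infmx R :=
  infmx_of_cols (fun k =>
    if k is j.+1 then fps_mul (fps_mul (fps_t R) g) (fps_exp f j) else d).

(* [d, h] = (d, h, t h, t^2 h, ...) *)
Definition quasi_riordan (R : realType) (d h : fps R) : infmx R :=
  infmx_of_cols (fun k =>
    if k is j.+1 then fps_mul (fps_exp (fps_t R) j) h else d).

(* The minor of order m on the rows r 0 < ... < r (m-1) and the columns
   c 0 < ... < c (m-1). *)
Definition minor (R : realType) (A : infmx R) (m : nat) (r c : 'I_m -> nat)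
  : R := \det (\matrix_(i < m, j < m) A (r i) (c j)).

Definition totally_positive (R : realType) (A : infmx R) : Prop :=
  forall (m : nat) (r c : 'I_m -> nat),
    (forall i j : 'I_m, (i < j)%N -> (r i < r j)%N) ->
    (forall i j : 'I_m, (i < j)%N -> (c i < c j)%N) ->
    0 <= minor A r c.

Definition toeplitz (R : realType) (a : nat -> R) : infmx R :=
  fun i j => if (j <= i)%N then a (i - j)%N else 0.

Definition polya_frequency (R : realType) (a : nat -> R) : Prop :=
  (forall n, 0 <= a n) /\ totally_positive (toeplitz a).

(* Main.v *)
Require Import Defs.
From mathcomp Require Import all_boot all_order all_fingroup all_algebra.
From mathcomp Require Import reals.

(** Both [(d | g, f) = [d, t g] (1 (+) (1, f))] and
    [(1, f) = [1, f] (1 (+) (1, f))] hold, where [(1, f) = (1, f, f^2, ...)].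
    By Cauchy-Binet a product of totally positive matrices is totally positive.
    The second identity expresses the first [n + 1] columns of [(1, f)] through
    its first [n] columns and [[1, f]], which is [1 (+)] a submatrix of the
    Toeplitz matrix of [f]; so [(1, f)] is totally positive by induction on [n],
    and the first identity concludes. *)

Import Order.TTheory GRing.Theory Num.Theory.
Local Open Scope ring_scope.

(** * Determinants of products: the Cauchy-Binet formula *)

Lemma det_rowsub_perm {R : comNzRingType} {m n : nat} (s : 'S_m)
    (f : 'I_m -> 'I_n) (B : 'M[R]_(n, m)) :
  \det (rowsub (f \o s) B) = (-1) ^+ s * \det (rowsub f B).
Proof.
rewrite -det_perm -det_mulmx -row_permE; congr (\det _).
by apply/matrixP=> i j; rewrite !mxE.
Qed.

Lemma det_colsub_perm {R : comNzRingType} {m n : nat} (s : 'S_m)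
    (f : 'I_m -> 'I_n) (A : 'M[R]_(m, n)) :
  \det (colsub (f \o s) A) = (-1) ^+ s * \det (colsub f A).
Proof.
rewrite -[LHS]det_tr -[\det (colsub f A)]det_tr !trmx_mxsub.
exact: det_rowsub_perm.
Qed.

(** Multiplying out the product over the rows picks an index [f i] for each row [i]; the sum over
    permutations then assembles [\det (rowsub f B)]. *)
Lemma det_mulmx_rowsub {R : comNzRingType} {m n : nat}
    (A : 'M[R]_(m, n)) (B : 'M[R]_(n, m)) :
  \det (A *m B) = \sum_(f : {ffun 'I_m -> 'I_n})
                     (\prod_i A i (f i)) * \det (rowsub f B).
Proof.
transitivity (\sum_(f : {ffun 'I_m -> 'I_n}) \sum_(s : 'S_m)
                (-1) ^+ s * \prod_i (A i (f i) * B (f i) (s i))).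
  rewrite exchange_big; apply: eq_bigr => /= s _; rewrite -big_distrr /=.
  congr (_ * _); rewrite -(bigA_distr_bigA (fun i k => A i k * B k (s i))) /=.
  by apply: eq_bigr => i _; rewrite mxE.
apply: eq_bigr => f _; rewrite big_distrr; apply: eq_bigr => s _ /=.
rewrite mulrCA big_split /=; congr (_ * (_ * _)).
by apply: eq_bigr => i _; rewrite mxE.
Qed.

(* The Cauchy-Binet formula, symmetrized: summing over all maps [f] rather than
   over the increasing ones counts every maximal minor [m`!] times. *)
Lemma det_mulmx_fact {R : comNzRingType} {m n : nat}
    (A : 'M[R]_(m, n)) (B : 'M[R]_(n, m)) :
  \det (A *m B) *+ m`! = \sum_(f : {ffun 'I_m -> 'I_n})
                            \det (colsub f A) * \det (rowsub f B).
Proof.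
have -> : \sum_(f : {ffun 'I_m -> 'I_n}) \det (colsub f A) * \det (rowsub f B)
    = \sum_(s : 'S_m) \sum_(f : {ffun 'I_m -> 'I_n})
        (-1) ^+ s * (\prod_i A i (f (s i))) * \det (rowsub f B).
  rewrite exchange_big; apply: eq_bigr => f _ /=; rewrite big_distrl /=.
  apply: eq_bigr => s _; congr (_ * _ * _).
  by apply: eq_bigr => i _; rewrite mxE.
(* The factorial counts the permutations, so each [s] has to contribute [\det (A *m B)]. Replacing
   [f] by [f \o s^-1] clears [s] from the product and releases a sign that cancels [(-1) ^+ s]. *)
rewrite -card_Sn -sumr_const; apply: eq_big => [s|s _]; first by rewrite inE.
rewrite det_mulmx_rowsub.
pose h (t : 'S_m) (f : {ffun 'I_m -> 'I_n}) := [ffun i => f (t i)].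
rewrite [RHS](reindex (h s^-1)%g) /=; last first.
  by exists (h s) => f _; apply/ffunP=> i; rewrite !ffunE ?permK ?permKV.
apply: eq_bigr => f _.
have -> : rowsub (h s^-1%g f) B = rowsub (f \o s^-1%g) B.
  by apply/matrixP=> i j; rewrite !mxE ffunE.
rewrite det_rowsub_perm odd_permV mulrACA -signr_addb addbb mul1r.
by congr (_ * _); apply: eq_bigr => i _; rewrite ffunE permK.
Qed.

(** * Total positivity of products *)

Definition increasing {m : nat} (r : 'I_m -> nat) : Prop :=
  forall i j : 'I_m, (i < j)%N -> (r i < r j)%N.

Lemma increasing_perm {m : nat} (r : 'I_m -> nat) :
  injective r -> exists s : 'S_m, increasing (r \o s).
Proof.
move=> rI; pose t := [tuple r i | i < m].
have /tuple_permP[s Es] : perm_eq (sort leq t) t by rewrite perm_sort.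
exists s => i j lt_ij.
have uniq_t : uniq (sort leq t).
  by rewrite sort_uniq map_inj_uniq // enum_uniq.
have sorted_t : sorted ltn (sort leq t).
  by rewrite ltn_sorted_uniq_leq uniq_t sort_sorted //; apply: leq_total.
have nthE (k : 'I_m) : r (s k) = nth 0%N (sort leq t) k.
  by rewrite Es -tnth_nth !tnth_mktuple.
rewrite /= !nthE; apply: (sorted_ltn_nth ltn_trans) => //;
  by rewrite inE size_sort size_tuple.
Qed.

(** The bound [n] on the columns is the parameter of the induction in [riordan1_tp]. *)
Definition tp_cols {R : realType} (A : infmx R) (n : nat) : Prop :=
  forall (m : nat) (r c : 'I_m -> nat), increasing r -> increasing c ->
    (forall j, c j < n)%N -> 0 <= minor A r c.

Lemma tp_colsP {R : realType} (A : infmx R) :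
  totally_positive A <-> forall n, tp_cols A n.
Proof.
split=> [tpA n m r c r_inc c_inc _ | tpA m r c r_inc c_inc]; first exact: tpA.
apply: (tpA (\max_i c i).+1) => // j.
by rewrite ltnS (leq_bigmax (F := c)).
Qed.

(** Cauchy-Binet hands the columns [c] on to [B] unchanged, so the bound [n] carries over from [B]
    to [C], whereas the minors of [A] involve arbitrary columns. *)
Lemma tp_cols_mul {R : realType} (A B C : infmx R) (n : nat) :
  (forall i k, (i < k)%N -> A i k = 0) ->
  (forall i j, C i j = \sum_(k < i.+1) A i k * B k j) ->
  totally_positive A -> tp_cols B n -> tp_cols C n.
Proof.
move=> A_low CE tpA tpB m r c r_inc c_inc c_lt.
(* [N] exceeds every chosen row and [A] vanishes above the diagonal, so all the sums may run over
   the same range [k < N]. *)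
pose N := (\max_i r i).+1.
pose MA : 'M[R]_(m, N) := \matrix_(i, k) A (r i) k.
pose MB : 'M[R]_(N, m) := \matrix_(k, j) B k (c j).
have -> : minor C r c = \det (MA *m MB).
  congr (\det _); apply/matrixP=> i j; rewrite !mxE CE.
  have le_rN : ((r i).+1 <= N)%N by rewrite ltnS (leq_bigmax (F := r)).
  rewrite (big_ord_widen N (fun k => A (r i) k * B k (c j)) le_rN) big_mkcond.
  apply: eq_bigr => k _; rewrite !mxE ltnS; case: leqP => // lt_rk.
  by rewrite A_low ?mul0r.
rewrite -(pmulrn_lge0 _ (fact_gt0 m)) det_mulmx_fact sumr_ge0 // => f _.
(* An injective [f] can be sorted: the sign of the sorting permutation occurs in both determinants
   and cancels. Otherwise [f] repeats a row of [B] and the term is zero. *)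
have [/injectiveP f_inj | /injectivePn[i1 [i2 Di12 Ef12]]] := boolP (injectiveb f).
  have [s s_inc] : exists s : 'S_m, increasing ((val \o f) \o s).
    by apply: increasing_perm => i j /val_inj /f_inj.
  have -> : \det (colsub f MA) * \det (rowsub f MB)
            = \det (colsub (f \o s) MA) * \det (rowsub (f \o s) MB).
    by rewrite det_colsub_perm det_rowsub_perm mulrACA -signr_addb addbb mul1r.
  apply: mulr_ge0.
    have -> : colsub (f \o s) MA = \matrix_(i, j) A (r i) ((val \o f \o s) j).
      by apply/matrixP=> i j; rewrite !mxE.
    exact: tpA.
  have -> : rowsub (f \o s) MB = \matrix_(i, j) B ((val \o f \o s) i) (c j).
    by apply/matrixP=> i j; rewrite !mxE.
  exact: tpB.
by rewrite [\det (rowsub _ _)](determinant_alternate Di12) ?mulr0 // => j;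
  rewrite !mxE Ef12.
Qed.

(** * The direct sum of 1 and a matrix *)

Definition dsum1 {R : realType} (B : infmx R) : infmx R := fun i j =>
  match i, j with
  | 0, 0 => 1
  | i'.+1, j'.+1 => B i' j'
  | _, _ => 0
  end.

Lemma increasing_gt0 {m : nat} (r : 'I_m.+1 -> nat) (i : 'I_m) :
  increasing r -> (0 < r (lift ord0 i))%N.
Proof. by move=> /(_ ord0 (lift ord0 i) isT); apply: leq_ltn_trans. Qed.

Lemma increasing_pred {m : nat} (r : 'I_m -> nat) :
  increasing r -> (forall i, 0 < r i)%N -> increasing (fun i => (r i).-1).
Proof. by move=> r_inc r_gt0 i j /r_inc; rewrite -!subn1 ltn_sub2rE. Qed.

Lemma minor_dsum1_pred {R : realType} (B : infmx R) (m : nat)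
    (r c : 'I_m -> nat) :
  (forall i, 0 < r i)%N -> (forall j, 0 < c j)%N ->
  minor (dsum1 B) r c = minor B (fun i => (r i).-1) (fun j => (c j).-1).
Proof.
move=> r_gt0 c_gt0; congr (\det _); apply/matrixP=> i j; rewrite !mxE.
by case: (r i) (r_gt0 i) (c j) (c_gt0 j) => [|p] // _ [|q].
Qed.

Lemma tp_cols_dsum1 {R : realType} (B : infmx R) (n : nat) :
  tp_cols B n -> tp_cols (dsum1 B) n.+1.
Proof.
move=> tpB [|m] r c r_inc c_inc c_lt; first by rewrite /minor det_mx00.
have gt0_all (q : 'I_m.+1 -> nat) : increasing q -> (0 < q ord0)%N ->
    forall i, (0 < q i)%N.
  move=> q_inc q0 i; case: (unliftP ord0 i) => [k|] -> //.
  exact: increasing_gt0.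
have c_pred k : (0 < c k)%N -> ((c k).-1 < n)%N.
  by move: (c_lt k); case: (c k).
(* Row 0 of [dsum1 B] is (1, 0, 0, ...): choosing it makes the minor zero or, if column 0 is chosen
   as well, leaves a minor of [B]. *)
case: (posnP (r ord0)) => [r0 | /(gt0_all _ r_inc) r_gt0].
  rewrite /minor (expand_det_row _ ord0) big_ord_recl big1 => [|k _]; last first.
    by rewrite mxE r0; case: (c _) (increasing_gt0 c k c_inc) => // *; rewrite mul0r.
  rewrite addr0 mxE r0; case: (posnP (c ord0)) => [c0 | c0]; last first.
    by case: (c ord0) c0 => // *; rewrite mul0r.
  rewrite c0 mul1r /cofactor expr0 mul1r.
  have -> : row' ord0 (col' ord0 (\matrix_(i, j) dsum1 B (r i) (c j)))
     = \matrix_(i, j) dsum1 B ((r \o lift ord0) i) ((c \o lift ord0) j).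
    by apply/matrixP=> i j; rewrite !mxE.
  rewrite -/(minor _ (r \o lift ord0) (c \o lift ord0)).
  have r1 i : (0 < (r \o lift ord0) i)%N by exact: increasing_gt0.
  have c1 j : (0 < (c \o lift ord0) j)%N by exact: increasing_gt0.
  rewrite minor_dsum1_pred //; apply: tpB => [||j]; last exact/c_pred/c1.
    by apply: increasing_pred => // i j lt_ij; apply: r_inc.
  by apply: increasing_pred => // i j lt_ij; apply: c_inc.
(* Column 0 without row 0 is a zero column. *)
case: (posnP (c ord0)) => [c0 | /(gt0_all _ c_inc) c_gt0].
  rewrite /minor (expand_det_col _ ord0) big1 // => i _; rewrite mxE c0.
  by case: (r i) (r_gt0 i) => // *; rewrite mul0r.
rewrite minor_dsum1_pred //; apply: tpB => [||j]; last exact/c_pred.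
  exact: increasing_pred.
exact: increasing_pred.
Qed.

Lemma tp_dsum1 {R : realType} (B : infmx R) :
  totally_positive B -> totally_positive (dsum1 B).
Proof.
move=> /tp_colsP tpB m r c r_inc c_inc.
by apply: (tp_cols_dsum1 B (\max_j c j)) => // j; rewrite ltnS (leq_bigmax (F := c)).
Qed.

(** * Quasi-Riordan arrays and the factorizations *)

Lemma fps_mul_shift {R : realType} (k : nat) (a b : fps R) (n : nat) :
  (forall i, a i = (i == k)%:R) ->
  fps_mul a b n = if (k <= n)%N then b (n - k)%N else 0.
Proof.
move=> aE; rewrite /fps_mul; case: leqP => [le_kn | lt_nk].
  rewrite (bigD1 (Ordinal (le_kn : (k < n.+1)%N))) //= aE eqxx mul1r.
  rewrite big1 ?addr0 // => i ne_ik.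
  by rewrite aE [(_ == _ :> nat)](negPf ne_ik) mul0r.
rewrite big1 // => i _; rewrite aE ltn_eqF ?mul0r //.
exact: leq_ltn_trans (leq_ord i) lt_nk.
Qed.

Lemma fps_exp_t {R : realType} (k i : nat) :
  fps_exp (fps_t R) k i = (i == k)%:R.
Proof.
elim: k i => [|k IHk] i //=; rewrite (fps_mul_shift 1) //.
by case: i => [|i] //; rewrite subn1 IHk eqSS.
Qed.

Lemma fps_mul_rev {R : realType} (a b : fps R) (n : nat) :
  fps_mul a b n = \sum_(k < n.+1) a (n - k)%N * b k.
Proof.
rewrite /fps_mul (reindex_inj rev_ord_inj); apply: eq_bigr => k _ /=.
by rewrite subSS subKn // -ltnS.
Qed.

Lemma quasi_riordan_succ {R : realType} (d h : fps R) (i k : nat) :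
  quasi_riordan d h i k.+1 = if (k <= i)%N then h (i - k)%N else 0.
Proof. by apply: fps_mul_shift => n; apply: fps_exp_t. Qed.

Lemma quasi_riordan_low {R : realType} (d h : fps R) (i k : nat) :
  h 0%N = 0 -> (i < k)%N -> quasi_riordan d h i k = 0.
Proof.
case: k => // k h0; rewrite ltnS quasi_riordan_succ -subn_eq0 => /eqP ->.
by rewrite h0 if_same.
Qed.

(* The columns of the product are [d, h * u_0, h * u_1, ...], where the [u_j]
   are the columns of [B]. *)
Lemma quasi_riordan_dsum1 {R : realType} (d h : fps R) (B C : infmx R) :
  h 0%N = 0 -> (forall i, C i 0%N = d i) ->
  (forall i j, C i j.+1 = fps_mul h (B^~ j) i) ->
  forall i j, C i j = \sum_(k < i.+1) quasi_riordan d h i k * dsum1 B k j.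
Proof.
move=> h0 C0 CS i [|j]; rewrite big_ord_recl /=.
  by rewrite big1 ?addr0 ?mulr1 // => k _; rewrite mulr0.
(* The term [k = i] of the convolution has the factor [h 0 = 0]. In the remaining ones, row [k] of
   [B] meets column [k.+1] of the quasi-Riordan array. *)
rewrite mulr0 add0r CS fps_mul_rev big_ord_recr /= subnn h0 mul0r addr0.
apply: eq_bigr => k _; congr (_ * _).
by rewrite -[RHS]/(quasi_riordan d h i k.+1) quasi_riordan_succ ltnW.
Qed.

Definition riordan1 {R : realType} (f : fps R) : infmx R :=
  infmx_of_cols (fps_exp f).

Lemma quasi_riordan1_tp {R : realType} (f : fps R) :
  f 0%N = 0 -> polya_frequency f -> totally_positive (quasi_riordan (fps_one R) f).
Proof.
move=> f0 [_ tpT].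
(* Without its row 0 and column 0, [[1, f]] is the Toeplitz matrix of [f] with the top row deleted;
   row 0 is (1, 0, 0, ...) because [f 0 = 0]. *)
have QE : quasi_riordan (fps_one R) f =2 dsum1 (fun i j => toeplitz f i.+1 j).
  by move=> [|i] [|j] //; rewrite quasi_riordan_succ // f0 if_same.
move=> m r c r_inc c_inc.
have -> : minor (quasi_riordan (fps_one R) f) r c
          = minor (dsum1 (fun i j => toeplitz f i.+1 j)) r c.
  by congr (\det _); apply/matrixP=> i j; rewrite !mxE QE.
apply: tp_dsum1 => // p r' c' r'_inc c'_inc.
by apply: (tpT p (fun i => (r' i).+1)) => // i j /r'_inc.
Qed.

Lemma riordan1_tp {R : realType} (f : fps R) :
  f 0%N = 0 -> polya_frequency f -> totally_positive (riordan1 f).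
Proof.
move=> f0 pf_f; apply/tp_colsP; elim=> [|n IHn].
  (* No column is available, so only the empty minor, equal to 1, remains. *)
  by move=> [|m] r c _ _ c_lt; [rewrite /minor det_mx00 | have := c_lt ord0].
apply: (tp_cols_mul (quasi_riordan (fps_one R) f) (dsum1 (riordan1 f))).
- by move=> i k; apply: quasi_riordan_low f0.
- exact: (quasi_riordan_dsum1 _ _ (riordan1 f)).
- exact: quasi_riordan1_tp.
- exact: tp_cols_dsum1.
Qed.

Theorem corollary2p7 (R : realType) (d g f : fps R)
  (hd : fps_order 0 d) (hg : fps_order 0 g) (hf : fps_order 1 f)
  (hPF : polya_frequency f)
  (hTP : totally_positive (quasi_riordan d (fps_mul (fps_t R) g))) :
  totally_positive (almost_riordan d g f).
Proof.
have f0 : f 0%N = 0 by apply: (proj1 hf).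
have tg0 : fps_mul (fps_t R) g 0%N = 0 by rewrite (fps_mul_shift 1).
apply/tp_colsP => n.
apply: (tp_cols_mul _ _ _ _ _ _ hTP).
- by move=> i k; apply: quasi_riordan_low tg0.
(* By definition, column [j.+1] of the array is [t g] times [f^j], which is column [j] of
   [riordan1 f]. *)
- exact: (quasi_riordan_dsum1 _ _ (riordan1 f)).
- exact/(proj1 (tp_colsP _))/tp_dsum1/riordan1_tp.
Qed.
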